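(* Let $\alpha\in(0,1)$ and let $n\ge2$. In a network of $n$ firms, the maximum possible value of any coefficient in the influence vector is $$\frac{1-\frac{n-1}{n}\alpha}{2-\alpha}.$$ That is, for every input-output linkage matrix $W$ of $n$ firms and every $i\in\{1,\dots,n\}$ the $i$-th coordinate of $v_W$ is at most this value, and there exist such $W$ and $i$ for which equality holds.
   Context: An input-output linkage matrix of $n$ firms is a real $n\times n$ matrix $W=(w_{ij})$ with $w_{ij}\ge 0$, $w_{ii}=0$ and $\sum_{j=1}^n w_{ij}=1$ for all $i$. With $W'$ the transpose of $W$ and $\vec{\mathbf 1}$ the all-ones column vector, the influence vector of $W$ (for the parameter $\alpha\in(0,1)$) is $v_W=\frac{\alpha}{n}(I-(1-\alpha)W')^{-1}\vec{\mathbf 1}$ (the inverse exists). *)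

(* Defs.v *)
From mathcomp Require Import all_boot all_order all_algebra.
From mathcomp Require Import reals.

Set Implicit Arguments.
Unset Strict Implicit.
Unset Printing Implicit Defensive.

Import Order.TTheory GRing.Theory Num.Theory.

Local Open Scope ring_scope.

Definition linkage_matrix (R : realType) (n : nat) (W : 'M[R]_n) : Prop :=
  [/\ forall i j, 0 <= W i j,
      forall i, W i i = 0
    & forall i, \sum_j W i j = 1].

(* [invmx A] is [A] itself when [A] is singular; [influence_unitmx] below
   shows that this junk value never occurs for linkage matrices. *)
Definition influence_vector (R : realType) (n : nat) (alpha : R)
    (W : 'M[R]_n) : 'cV[R]_n :=
  (alpha / n%:R) *: (invmx (1%:M - (1 - alpha) *: W^T) *m const_mx 1).

Lemma influence_unitmx (R : realType) (n : nat) (alpha : R) (W : 'M[R]_n) :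
  0 < alpha < 1 -> linkage_matrix W ->
  1%:M - (1 - alpha) *: W^T \in unitmx.
Proof.
move=> /andP[a0 a1] [W0 _ W1]; rewrite unitmxE unitfE; apply/negP => /det0P.
case=> v /rV0Pn[k vk] /eqP; rewrite mulmxBr mulmx1 subr_eq0 => /eqP ev.
have evE j : v 0 j = (1 - alpha) * \sum_l v 0 l * W j l.
  rewrite {1}ev -scalemxAr !mxE; congr (_ * _).
  by apply: eq_bigr => l _; rewrite !mxE.
have [j _ jmax] := @arg_maxP _ R _ k xpredT (fun l => `|v 0 l|) isT.
have c0 : 0 <= 1 - alpha by rewrite subr_ge0 ltW.
have vj : 0 < `|v 0 j|.
  by apply: lt_le_trans (jmax k isT); rewrite normr_gt0.
have : `|v 0 j| <= (1 - alpha) * `|v 0 j|.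
  rewrite {1}evE normrM (ger0_norm c0) ler_wpM2l //.
  apply: le_trans (ler_norm_sum _ _ _) _.
  rewrite -[leRHS]mulr1 -(W1 j) mulr_sumr ler_sum // => l _.
  by rewrite normrM (ger0_norm (W0 _ _)) ler_wpM2r //; exact: jmax.
rewrite mulrBl mul1r lerDl.
by rewrite oppr_ge0 leNgt mulr_gt0.
Qed.

(* Main.v *)
Require Import Defs.
From mathcomp Require Import all_boot all_order all_algebra.
From mathcomp Require Import reals.
From mathcomp Require Import ring lra.

Import Order.TTheory GRing.Theory Num.Theory.

Local Open Scope ring_scope.

(* The influence vector is the solution of [v = alpha/n + (1 - alpha) W' v].
   Summing coordinates gives [\sum_l v_l = 1], and summing absolute values gives
   [\sum_l `|v_l| <= 1]. As [W i i = 0] and the other entries of column [i] are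
   at most 1, [v_i <= alpha/n + (1 - alpha) (1 - v_i)]. This is an equality when
   every firm other than [i] buys only from [i]. *)

Section Influence.
Context {R : realType} {n : nat} {alpha : R} {W : 'M[R]_n}.
Hypotheses (alpha01 : 0 < alpha < 1) (Wlink : linkage_matrix W).

Local Notation v := (influence_vector alpha W).

Lemma influence_vectorE j :
  v j 0 = alpha / n%:R + (1 - alpha) * \sum_l W l j * v l 0.
Proof.
have : (1%:M - (1 - alpha) *: W^T) *m v = (alpha / n%:R) *: const_mx 1.
  by rewrite -scalemxAr mulmxA mulmxV ?mul1mx // influence_unitmx.
move: (influence_vector alpha W) => u /matrixP/(_ j 0).
rewrite mulmxBl mul1mx -scalemxAl !mxE mulr1 => <-.
by under [X in _ - _ * X]eq_bigr => l _ do rewrite mxE; rewrite subrK.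
Qed.

Lemma linkage_matrix_le1 i j : W i j <= 1.
Proof.
have [W0 _ W1] := Wlink.
by rewrite -(W1 i) (bigD1 j) //= lerDl sumr_ge0.
Qed.

(** Rows of [W] sum to 1, so its transpose preserves coordinate totals. Used with [f] equal to the
    influence vector and to its absolute values. *)
Lemma linkage_matrix_sum_mul (f : 'I_n -> R) :
  \sum_j \sum_l W l j * f l = \sum_l f l.
Proof.
have [_ _ W1] := Wlink; rewrite exchange_big /=.
by apply: eq_bigr => l _; rewrite -mulr_suml W1 mul1r.
Qed.

Lemma sum_const_alpha : (0 < n)%N -> \sum_(j < n) alpha / n%:R = alpha.
Proof.
by move=> n0; rewrite sumr_const card_ord -[LHS]mulr_natr divfK ?pnatr_eq0 -?lt0n.
Qed.

Lemma influence_vector_sum : (0 < n)%N -> \sum_l v l 0 = 1.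
Proof.
move=> n0; have a0 : alpha != 0 by case/andP: alpha01 => /gt_eqF ->.
apply: (mulfI a0); rewrite mulr1.
have : \sum_l v l 0 = alpha + (1 - alpha) * \sum_l v l 0.
  under [LHS]eq_bigr => j _ do rewrite influence_vectorE.
  by rewrite big_split /= sum_const_alpha // -mulr_sumr linkage_matrix_sum_mul.
by move=> ?; lra.
Qed.

(** Takes the place of a proof that [v] is nonnegative. The triangle inequality turns the
    fixed-point equation into an inequality between absolute values, which is then summed over the
    coordinates. *)
Lemma influence_vector_sum_norm : (0 < n)%N -> \sum_l `|v l 0| <= 1.
Proof.
move=> n0; have [W0 _ _] := Wlink; have /andP[a0 a1] := alpha01.
rewrite -(ler_pM2l a0) mulr1.
suff : \sum_l `|v l 0| <= alpha + (1 - alpha) * \sum_l `|v l 0| by lra.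
rewrite -[in leRHS]linkage_matrix_sum_mul mulr_sumr.
rewrite -[X in X + _]sum_const_alpha // -big_split /=; apply: ler_sum => j _.
rewrite influence_vectorE; apply: (le_trans (ler_normD _ _)).
rewrite ger0_norm; last by rewrite divr_ge0 ?ler0n // ltW.
rewrite lerD2l normrM ger0_norm; last by lra.
apply: ler_wpM2l; first by lra.
apply: (le_trans (ler_norm_sum _ _ _)); apply: ler_sum => l _.
by rewrite normrM ger0_norm.
Qed.

Lemma influence_vector_le i :
  (2 - alpha) * v i 0 <= alpha / n%:R + (1 - alpha).
Proof.
have n0 : (0 < n)%N by apply: leq_ltn_trans (ltn_ord i).
have [W0 Wii _] := Wlink; have /andP[a0 a1] := alpha01.
(* Collecting the two occurrences of [v i 0] produces the factor [2 - alpha]. *)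
suff : v i 0 <= alpha / n%:R + (1 - alpha) * (1 - v i 0) by lra.
rewrite {1}influence_vectorE lerD2l ler_wpM2l //; first by lra.
rewrite (bigD1 i) //= Wii mul0r add0r.
(* The signs of the [v l 0] are not known, so absolute values come before replacing the weights by
   1. *)
apply: (@le_trans _ _ (\sum_(l | l != i) `|v l 0|)).
  apply: ler_sum => l _; apply: le_trans (ler_norm _) _.
  by rewrite normrM ger0_norm // ler_piMl // linkage_matrix_le1.
(* The sum off [i] is at most 1 minus the absolute value of [v i 0], hence at most [1 - v i 0]. *)
have := influence_vector_sum_norm n0; rewrite (bigD1 i) //=.
have := ler_norm (v i 0); lra.
Qed.

(** Column [i] now collects every other coordinate with full weight, and since the total is exactly
    1 this gives [1 - v i 0]. *)
Lemma influence_vector_eq i : (forall l, l != i -> W l i = 1) ->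
  (2 - alpha) * v i 0 = alpha / n%:R + (1 - alpha).
Proof.
move=> Wi; have n0 : (0 < n)%N by apply: leq_ltn_trans (ltn_ord i).
have [_ Wii _] := Wlink.
suff : v i 0 = alpha / n%:R + (1 - alpha) * (1 - v i 0) by lra.
rewrite {1}influence_vectorE; congr (_ + _ * _).
rewrite -(influence_vector_sum n0) (bigD1 i) //= Wii mul0r add0r.
rewrite [in RHS](bigD1 i) //= addrC addrK.
by apply: eq_bigr => l /Wi ->; rewrite mul1r.
Qed.

End Influence.

(** The star network with centre [i]. The centre cannot buy from itself, yet its row must sum to 1,
    hence the supplier [k]; column [i] is the same for every such [k]. *)
Lemma star_linkage_matrix {R : realType} {n : nat} {i k : 'I_n} : k != i ->
  linkage_matrix
    (\matrix_(l, j) (j == (if l == i then k else i))%:R : 'M[R]_n).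
Proof.
move=> ki; split=> [l j|l|l]; first by rewrite mxE ler0n.
  rewrite mxE; have [->|li] := eqVneq l i; first by rewrite eq_sym (negPf ki).
  by rewrite (negPf li).
rewrite (bigD1 (if l == i then k else i)) //= mxE eqxx big1 ?addr0 // => j jl.
by rewrite mxE (negPf jl).
Qed.

Theorem theorem4p1 (R : realType) (n : nat) (alpha : R)
    (hn : (2 <= n)%N) (halpha : 0 < alpha < 1) :
  let M : R := (1 - (n%:R - 1) / n%:R * alpha) / (2 - alpha) in
  (forall (W : 'M[R]_n) (i : 'I_n),
      linkage_matrix W -> influence_vector alpha W i 0 <= M) /\
  (exists (W : 'M[R]_n) (i : 'I_n),
      linkage_matrix W /\ influence_vector alpha W i 0 = M).
Proof.
move=> M.
have a2 : 0 < 2 - alpha by case/andP: halpha => *; lra.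
(* Writing [(n - 1) / n] as [1 - 1 / n] brings [M] to the form of the bound. *)
have -> : M = (alpha / n%:R + (1 - alpha)) / (2 - alpha).
  have n0 : n%:R != 0 :> R by rewrite pnatr_eq0 -lt0n ltnW.
  by rewrite /M; congr (_ / _); field.
split=> [W i Wlink|].
  by rewrite ler_pdivlMr // mulrC influence_vector_le.
(* Since [n] is at least 2, firm 0 can be the centre and firm 1 its supplier. *)
pose i : 'I_n := Ordinal (ltnW hn); pose k : 'I_n := Ordinal hn.
have Wlink := @star_linkage_matrix R n i k isT.
eexists; exists i; split; first exact: Wlink.
apply/(canRL (mulfK (lt0r_neq0 a2))).
rewrite mulrC (influence_vector_eq halpha Wlink) // => l /negPf li.
by rewrite mxE li eqxx.
Qed.
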